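(* Let $(\mathfrak{g},[\cdot,\cdot,\cdot]_{\mathfrak{g}})$ be a 3-Leibniz algebra and $T:\mathfrak{g}\to\mathfrak{g}$ an averaging operator. Then $\mathfrak{g}$ is also equipped with a 3-tri-Leibniz algebra structure defined by $$[x,y,z]_{\vdash}^T=[Tx,Ty,z]_{\mathfrak{g}},\quad [x,y,z]_{\perp}^T=[Tx,y,Tz]_{\mathfrak{g}},\quad [x,y,z]_{\dashv}^T=[x,Ty,Tz]_{\mathfrak{g}}$$ for all $x,y,z\in\mathfrak{g}$.
   Context: All vector spaces and (multi)linear maps are over a field $\mathbb{K}$ of characteristic zero. 3-Leibniz algebra: a vector space $\mathfrak{g}$ with a trilinear map $[\cdot,\cdot,\cdot]_{\mathfrak{g}}:\mathfrak{g}\times\mathfrak{g}\times\mathfrak{g}\to\mathfrak{g}$ such that $[a,b,[x,y,z]]=[[a,b,x],y,z]+[x,[a,b,y],z]+[x,y,[a,b,z]]$ for all $a,b,x,y,z\in\mathfrak{g}$. Averaging operator on $\mathfrak{g}$: a linear map $T:\mathfrak{g}\to\mathfrak{g}$ with $[Tx,Ty,Tz]_{\mathfrak{g}}=T[Tx,Ty,z]_{\mathfrak{g}}=T[Tx,y,Tz]_{\mathfrak{g}}=T[x,Ty,Tz]_{\mathfrak{g}}$ for all $x,y,z\in\mathfrak{g}$. 3-tri-Leibniz algebra: a vector space with three trilinear brackets $[\cdot,\cdot,\cdot]_{\dashv},[\cdot,\cdot,\cdot]_{\perp},[\cdot,\cdot,\cdot]_{\vdash}$ such that for all elements $x,y,z,a,b$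 and all choices of $\triangle\in\{\vdash,\dashv,\perp\}$ (each occurrence of $\triangle$ may be chosen independently): (i) $[a,b,[x,y,z]_{\triangle}]_{\dashv}=[[a,b,x]_{\dashv},y,z]_{\dashv}+[x,[a,b,y]_{\dashv},z]_{\perp}+[x,y,[a,b,z]_{\dashv}]_{\vdash}$; (ii) $[a,b,[x,y,z]_{\dashv}]_{\vdash}=[[a,b,x]_{\vdash},y,z]_{\dashv}+[x,[a,b,y]_{\triangle},z]_{\dashv}+[x,y,[a,b,z]_{\triangle}]_{\dashv}$; (iii) $[a,b,[x,y,z]_{\vdash}]_{\vdash}=[[a,b,x]_{\triangle},y,z]_{\vdash}+[x,[a,b,y]_{\triangle},z]_{\vdash}+[x,y,[a,b,z]_{\vdash}]_{\vdash}$; (iv) $[a,b,[x,y,z]_{\perp}]_{\vdash}=[[a,b,x]_{\triangle},y,z]_{\perp}+[x,[a,b,y]_{\vdash},z]_{\perp}+[x,y,[a,b,z]_{\triangle}]_{\perp}$; (v) $[a,b,[x,y,z]_{\triangle}]_{\perp}=[[a,b,x]_{\perp},y,z]_{\dashv}+[x,[a,b,y]_{\perp},z]_{\perp}+[x,y,[a,b,z]_{\perp}]_{\vdash}$. *)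

(* Defs.v *)
From HB Require Import structures.
From mathcomp Require Import all_boot all_order all_algebra.

Set Implicit Arguments.
Unset Strict Implicit.
Unset Printing Implicit Defensive.

Import GRing.Theory.
Local Open Scope ring_scope.

Definition trilinear (K : fieldType) (g : lmodType K) (m : g -> g -> g -> g) : Prop :=
  [/\ forall y z : g, linear (fun x => m x y z),
      forall x z : g, linear (fun y => m x y z)
    & forall x y : g, linear (fun z => m x y z)].

Record three_Leibniz (K : fieldType) (g : lmodType K) (m : g -> g -> g -> g) : Prop :=
  ThreeLeibniz {
    three_Leibniz_trilinear : trilinear m;
    three_Leibniz_identity : forall a b x y z : g,
      m a b (m x y z) = m (m a b x) y z + m x (m a b y) z + m x y (m a b z)
  }.

Definition averaging_operator (K : fieldType) (g : lmodType K)
    (m : g -> g -> g -> g) (T : {linear g -> g}) : Prop :=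
  forall x y z : g,
    [/\ m (T x) (T y) (T z) = T (m (T x) (T y) z),
        m (T x) (T y) (T z) = T (m (T x) y (T z))
      & m (T x) (T y) (T z) = T (m x (T y) (T z))].

(* The labels of the brackets [_,_,_]_dashv, [_,_,_]_perp and [_,_,_]_vdash. *)
Inductive tri_label := Dashv | Perp | Vdash.

(* Each unspecified label (a triangle) is a separate variable s, t, ...: several
   triangles in one identity may stand for different brackets. *)
Record three_tri_Leibniz (K : fieldType) (g : lmodType K)
    (br : tri_label -> g -> g -> g -> g) : Prop :=
  ThreeTriLeibniz {
    tri_trilinear : forall t : tri_label, trilinear (br t);
    tri_dashv : forall (t : tri_label) (a b x y z : g),
      br Dashv a b (br t x y z) =
        br Dashv (br Dashv a b x) y z + br Perp x (br Dashv a b y) z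
        + br Vdash x y (br Dashv a b z);
    tri_vdash_dashv : forall (s t : tri_label) (a b x y z : g),
      br Vdash a b (br Dashv x y z) =
        br Dashv (br Vdash a b x) y z + br Dashv x (br s a b y) z
        + br Dashv x y (br t a b z);
    tri_vdash_vdash : forall (s t : tri_label) (a b x y z : g),
      br Vdash a b (br Vdash x y z) =
        br Vdash (br s a b x) y z + br Vdash x (br t a b y) z
        + br Vdash x y (br Vdash a b z);
    tri_vdash_perp : forall (s t : tri_label) (a b x y z : g),
      br Vdash a b (br Perp x y z) =
        br Perp (br s a b x) y z + br Perp x (br Vdash a b y) z
        + br Perp x y (br t a b z);
    tri_perp : forall (t : tri_label) (a b x y z : g),
      br Perp a b (br t x y z) =
        br Dashv (br Perp a b x) y z + br Perp x (br Perp a b y) z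
        + br Vdash x y (br Perp a b z)
  }.

Definition averaged_bracket (K : fieldType) (g : lmodType K)
    (m : g -> g -> g -> g) (T : {linear g -> g}) (t : tri_label) (x y z : g) : g :=
  match t with
  | Vdash => m (T x) (T y) z
  | Perp => m (T x) y (T z)
  | Dashv => m x (T y) (T z)
  end.

(* Main.v *)
Require Import Defs.
From mathcomp Require Import all_boot all_order all_algebra.
Import GRing.Theory.
Local Open Scope ring_scope.

(** An averaged bracket of [x], [y], [z] applies [T] to two of the three
    arguments, and the averaging axioms say that applying [T] to the result
    gives [m (T x) (T y) (T z)] whichever argument was left bare
    ([averaged_bracketT]).  Expand both sides of a tri-Leibniz identity in terms
    of [m] and [T].  Every inner bracket whose label is arbitrary occurs under
    [T], so its label becomes irrelevant, and every other inner bracket occurs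
    bare, with the label determined by which of the five arguments carries no
    [T].  What remains is the 3-Leibniz identity of [m] in which four of the
    five arguments are replaced by their images under [T]; the five families
    of identities correspond to the five positions of the bare argument. *)

Section AveragedBracket.

Variables (K : fieldType) (g : lmodType K) (m : g -> g -> g -> g).
Variable T : {linear g -> g}.

Lemma averaged_bracketT (t : tri_label) (x y z : g) :
  averaging_operator m T ->
  T (averaged_bracket m T t x y z) = m (T x) (T y) (T z).
Proof. by move=> avT; case: (avT x y z) => eqV eqP eqD; case: t. Qed.

Lemma averaged_bracket_trilinear (t : tri_label) :
  trilinear m -> trilinear (averaged_bracket m T t).
Proof.
move=> [lin1 lin2 lin3].
by case: t; split=> u v k x y /=; rewrite ?linearP ?lin1 ?lin2 ?lin3.
Qed.

End AveragedBracket.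

Theorem corollary3p11 (K : fieldType) (charK0 : [pchar K] =i pred0)
    (g : lmodType K) (m : g -> g -> g -> g) (T : {linear g -> g}) :
  three_Leibniz m -> averaging_operator m T ->
  three_tri_Leibniz (averaged_bracket m T).
Proof.
move=> [trim leib] avT.
have brT t x y z := averaged_bracketT K g m T t x y z avT.
(* Only the outermost brackets may be unfolded at first: once the inner ones are
   unfolded as well, [brT] no longer matches them under [T]. *)
split=> [t|t a b x y z|s t a b x y z|s t a b x y z|s t a b x y z|t a b x y z].
- exact: averaged_bracket_trilinear.
- by rewrite {1 3 5 7}/averaged_bracket !brT /= leib.
- by rewrite {1 3 5 7}/averaged_bracket !brT /= leib.
- by rewrite {1 3 5 7}/averaged_bracket !brT /= leib.
- by rewrite {1 3 5 7}/averaged_bracket !brT /= leib.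
- by rewrite {1 3 5 7}/averaged_bracket !brT /= leib.
Qed.
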